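(* Let $R$ be a self left semi-injective ring. Then each flat left $R$-module is semi-compact if and only if $R$ is a quasi-Frobenius ring.
   Context: Rings are associative with identity and modules are unitary. A left $R$-module $M$ is semi-injective (or f-injective) if for each finitely generated left ideal $I$ of $R$ every $R$-homomorphism $I\to M$ extends to an $R$-homomorphism $R\to M$; $R$ is self left semi-injective if it is semi-injective as a left $R$-module. For a left ideal $I$ of $R$, $M[I]=\{m\in M\mid Im=0\}$. $M$ is semi-compact if every set of congruences $x\equiv x_\alpha\pmod{M[I_\alpha]}$ ($\alpha\in\Lambda$, $x_\alpha\in M$, $I_\alpha$ a left ideal of $R$), each finite subset of which has a common solution in $M$, has a simultaneous solution in $M$. *)

(* Defs.v *)
From HB Require Import structures.
From mathcomp Require Import all_boot all_order all_algebra.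
From mathcomp Require Import all_classical.
Set Implicit Arguments.
Unset Strict Implicit.
Unset Printing Implicit Defensive.
Import GRing.Theory.
Local Open Scope classical_set_scope.
Local Open Scope ring_scope.

(* Left R-modules are lmodType R.  Right R-modules are lmodType R^c, where R^c
   is the converse (opposite) ring of R; in particular the right ideals of R
   are the left ideals of R^c, and the regular right module is R^c^o. *)

Definition left_ideal (R : pzRingType) (I : set R) : Prop :=
  [/\ I 0,
      forall x y, I x -> I y -> I (x + y) &
      forall r x, I x -> I (r * x)].

Definition fg_left_ideal (R : pzRingType) (I : set R) : Prop :=
  exists (n : nat) (a : 'I_n -> R),
    I = [set x | exists c : 'I_n -> R, x = \sum_(i < n) c i * a i].

(* f is an R-homomorphism I -> M; the values of f outside I are irrelevant. *)
Definition ideal_hom (R : pzRingType) (M : lmodType R) (I : set R)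
    (f : R -> M) : Prop :=
  (forall x y, I x -> I y -> f (x + y) = f x + f y) /\
  (forall r x, I x -> f (r * x) = r *: f x).

Definition semi_injective (R : pzRingType) (M : lmodType R) : Prop :=
  forall I : set R, fg_left_ideal I ->
  forall f : R -> M, ideal_hom I f ->
  exists g : {linear R^o -> M}, forall x, I x -> g x = f x.

Definition self_left_semi_injective (R : pzRingType) : Prop :=
  @semi_injective R R^o.

(* M[I] *)
Definition annihilated (R : pzRingType) (M : lmodType R) (I : set R) : set M :=
  [set m | forall r, I r -> r *: m = 0].

Definition semi_compact (R : pzRingType) (M : lmodType R) : Prop :=
  forall (L : Type) (x : L -> M) (I : L -> set R),
    (forall a, left_ideal (I a)) ->
    (forall F : set L, finite_set F ->
       exists y : M, forall a, F a -> annihilated (I a) (y - x a)) ->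
    exists y : M, forall a, annihilated (I a) (y - x a).

(* The right action a.r on A is written (r : R^c) *: a. *)
Definition balanced (R : pzRingType) (A : lmodType R^c) (M : lmodType R)
    (Z : zmodType) (b : A -> M -> Z) : Prop :=
  [/\ forall a a' m, b (a + a') m = b a m + b a' m,
      forall a m m', b a (m + m') = b a m + b a m' &
      forall (r : R) a m, b ((r : R^c) *: a) m = b a (r *: m)].

Definition is_tensor (R : pzRingType) (A : lmodType R^c) (M : lmodType R)
    (T : zmodType) (t : A -> M -> T) : Prop :=
  balanced t /\
  forall (Z : zmodType) (b : A -> M -> Z), balanced b ->
    exists g : {additive T -> Z},
      (forall a m, g (t a m) = b a m) /\
      (forall h : {additive T -> Z}, (forall a m, h (t a m) = b a m) ->
         forall u, h u = g u).

(* - (x) M preserves injectivity.  Tensor products are unique up to unique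
   isomorphism, so quantifying over all of them makes no choice of model; g is
   the induced map f (x) M. *)
Definition flat (R : pzRingType) (M : lmodType R) : Prop :=
  forall (A B : lmodType R^c) (f : {linear A -> B}), injective f ->
  forall (TA TB : zmodType) (tA : A -> M -> TA) (tB : B -> M -> TB),
    is_tensor tA -> is_tensor tB ->
  forall g : {additive TA -> TB},
    (forall a m, g (tA a m) = tB (f a) m) -> injective g.

Definition injective_module (R : pzRingType) (M : lmodType R) : Prop :=
  forall (A B : lmodType R) (i : {linear A -> B}), injective i ->
  forall f : {linear A -> M},
  exists h : {linear B -> M}, forall a, h (i a) = f a.

Definition left_artinian (R : pzRingType) : Prop :=
  forall I : nat -> set R,
    (forall n, left_ideal (I n)) ->
    (forall n, I n.+1 `<=` I n) ->
    exists n, forall m, (n <= m)%N -> I m = I n.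

(* Two-sided artinian and two-sided self-injective. *)
Definition quasi_Frobenius (R : pzRingType) : Prop :=
  [/\ left_artinian R, left_artinian R^c,
      @injective_module R R^o & @injective_module R^c (R^c)^o].

(* Main.v *)
Require Import Defs.
From HB Require Import structures.
From mathcomp Require Import all_boot all_order all_algebra.
From mathcomp Require Import all_classical.

(** The proof is a study of annihilators. Write l and r for left and
    right annihilators in R; M[I] is r(I) when M = R.

    Suppose first that flat modules are semi-compact. The regular module is flat,
    and a homomorphism from a left ideal to R asks for a solution of congruences
    that are finitely solvable by semi-injectivity; so R is left self-injective
    ([semi_compact_self_injective], [baer]). The free module on countably many
    generators is flat, and semi-compactness of it forces the descending chain
    condition on right annihilators ([semi_compact_rann_dcc]).

    From these two facts alone R is quasi-Frobenius (a theorem of Faith). Let Z be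
    the left singular ideal. It is nilpotent ([singular_nilpotent]), and R/Z is
    semisimple ([idempotent_generator]) because R/Z is von Neumann regular. Let S
    be the left socle r(Z); then r(S) = Z. The crucial point is that every simple
    left module embeds in R, that is, l(S) = Z ([lann_socle]): indecomposable
    summands of R with different tops have different socles, so that the map from
    tops to socles is an injection of a finite set into itself. This is carried out
    with two-sided ideals, using the chain condition in place of counting. It
    follows that I = l(r(I)) for all left ideals I ([left_double_annihilator]), so R
    is left noetherian, and then left artinian ([noetherian_artinian]). On the
    other side, self-injectivity yields K = r(l(K)) for every right ideal K, first
    one generator at a time ([right_double_annihilator]). So l and r are inverse
    lattice anti-isomorphisms, R is right artinian, and l(A cap B) = l(A) + l(B)
    makes homomorphisms from right ideals extend ([right_self_injective]).

    Conversely, let R be quasi-Frobenius. Right self-injectivity and the chain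
    condition on right ideals give I = l(r(I)) by the same argument over the
    opposite ring, so R is left noetherian; over such a ring every module is
    semi-compact ([noetherian_semi_compact]). *)

Set Implicit Arguments.
Unset Strict Implicit.
Unset Printing Implicit Defensive.
Import GRing.Theory.
Local Open Scope classical_set_scope.
Local Open Scope ring_scope.

(** * Maximal and minimal members *)

(** By dependent choice, a nonempty family without such a member contains a
    strictly decreasing sequence. *)
Lemma minimal_member (T U : Type) (P : T -> Prop) (f : T -> set U) :
    (forall t : nat -> T, (forall n, P (t n)) ->
       (forall n, f (t n.+1) `<=` f (t n)) ->
       exists n, f (t n) `<=` f (t n.+1)) ->
  forall t0, P t0 ->
  exists t, P t /\ forall t', P t' -> f t' `<=` f t -> f t `<=` f t'.
Proof.
move=> dcc t0 P0; apply: contrapT => nomin.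
pose next (a b : {t | P t}) :=
  f (sval b) `<=` f (sval a) /\ ~ f (sval a) `<=` f (sval b).
have step a : {b | next a b}.
  apply: cid; apply: contrapT => nob; apply: nomin.
  exists (sval a); split=> [|t Pt le_t]; first exact: (svalP a).
  by apply: contrapT => nle; apply: nob; exists (exist P t Pt).
have [t [_ tS]] := dependent_choice step (exist P t0 P0).
have [|n|n tn] := dcc (fun n => sval (t n)).
- by move=> n; apply: (svalP (t n)).
- by case: (tS n).
- by case: (tS n).
Qed.

(** Zorn's lemma for extensions of a given set, where chains are nonempty so
    that the union of a chain of submodules is again a submodule. *)
Lemma maximal_above (T : Type) (good : set (set T)) (A : set T) :
    good A ->
    (forall F : set (set T), F !=set0 -> F `<=` good -> total_on F subset ->
       good (\bigcup_(X in F) X)) ->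
  exists M, [/\ good M, A `<=` M & forall B, good B -> M `<=` B -> B `<=` M].
Proof.
move=> gA gU.
have [|M [gM maxM]] := @Zorn_bigcup T (fun X => good (A `|` X)).
  move=> F Fgood Ftot; have [[X0 FX0]|/nonemptyPn ->] := pselect (F !=set0); last first.
    by rewrite bigcup_set0 setU0.
  have -> : A `|` \bigcup_(X in F) X = \bigcup_(Y in [set A `|` X | X in F]) Y.
    apply/seteqP; split=> x.
      case=> [Ax|[X FX Xx]]; first by exists (A `|` X0); [exists X0|left].
      by exists (A `|` X); [exists X|right].
    by case=> _ [X FX <-] [Ax|Xx]; [left|right; exists X].
  apply: gU.
  - by exists (A `|` X0); exists X0.
  - by move=> _ [X FX <-]; apply: Fgood.
  - move=> _ _ [X FX <-] [Y FY <-].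
    by case: (Ftot X Y FX FY) => XY; [left|right]; apply: setUS.
exists (A `|` M); split=> // B gB MB x Bx; right.
apply: contrapT => nMx; apply: (maxM B); last first.
  by rewrite setUidr // => y Ay; apply: MB; left.
by split=> [y My|BM]; [apply: MB; right|apply/nMx/BM].
Qed.

(** * Injectivity and Baer's criterion *)

Section Modules.
Variable R : pzRingType.

Definition submod (M : lmodType R) (N : set M) : Prop :=
  [/\ N 0, forall x y, N x -> N y -> N (x + y) & forall r x, N x -> N (r *: x)].

Lemma submodN (M : lmodType R) (N : set M) x : submod N -> N x -> N (- x).
Proof. by case=> _ _ NZ Nx; rewrite -scaleN1r; apply: NZ. Qed.

Lemma submodB (M : lmodType R) (N : set M) x y :
  submod N -> N x -> N y -> N (x - y).
Proof. by move=> sN Nx Ny; case: (sN) => _ ND _; apply: ND => //; apply: submodN. Qed.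

Lemma submod_bigcup (M : lmodType R) (F : set (set M)) :
    F !=set0 -> F `<=` @submod M -> total_on F subset ->
  submod (\bigcup_(X in F) X).
Proof.
move=> [X0 FX0] Fsub Ftot; split.
- by exists X0 => //; case: (Fsub _ FX0).
- move=> x y [X FX Xx] [Y FY Yy]; case: (Ftot X Y FX FY) => XY.
    by exists Y => //; case: (Fsub _ FY) => _ YD _; apply: YD => //; apply: XY.
  by exists X => //; case: (Fsub _ FX) => _ XD _; apply: XD => //; apply: XY.
- by move=> r x [X FX Xx]; exists X => //; case: (Fsub _ FX) => _ _; apply.
Qed.

(** A submodule of [B * M] is a linear relation; a univalent one is the graph of
    a linear map defined on a submodule of [B]. Graphs replace partially defined
    maps throughout. *)
Definition univalent (B M : lmodType R) (G : set (B * M)%type) : Prop :=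
  forall m, G (0, m) -> m = 0.

(** The hypothesis of Baer's criterion: homomorphisms from left ideals to [M],
    given by their graphs, are right multiplications by elements of [M]. *)
Definition ideal_injective (M : lmodType R) : Prop :=
  forall G : set (R^o * M)%type, submod G -> univalent G ->
  exists m : M, forall (r : R) (n : M), G (r, n) -> n = r *: m.

Lemma univalentP (B M : lmodType R) (G : set (B * M)%type) b m m' :
  submod G -> univalent G -> G (b, m) -> G (b, m') -> m = m'.
Proof.
move=> sG uG Gm Gm'; apply/eqP; rewrite -subr_eq0; apply/eqP/uG.
by have := submodB sG Gm Gm'; rewrite -[_ - _]/(_ - _, _ - _) /= subrr.
Qed.

(** Among the graphs extending that of [f] along [i] a maximal one is defined
    everywhere: if [b] were outside its domain, the relation [r |-> h (r *: b)]
    would be a homomorphism from a left ideal, hence a multiplication by some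
    [m], and [b |-> m] would extend it. *)
Lemma baer (M : lmodType R) : ideal_injective M -> injective_module M.
Proof.
move=> iM A B i inj_i f.
pose G0 : set (B * M)%type := [set p | exists a, p = (i a, f a)].
pose good (G : set (B * M)%type) := submod G /\ univalent G.
have [||G [[sG uG] G0G maxG]] := @maximal_above _ good G0.
- split; last first.
    by move=> m [a [i0 ->]]; rewrite (inj_i a 0) ?linear0.
  split; first by exists 0; rewrite !linear0.
    by move=> _ _ [a ->] [a' ->]; exists (a + a'); rewrite !linearD.
  by move=> r _ [a ->]; exists (r *: a); rewrite !linearZ.
- move=> F F0 Fgood Ftot; split.
    by apply: submod_bigcup => // X FX; case: (Fgood _ FX).
  by move=> m [X FX X0]; case: (Fgood _ FX) => _; apply.
have domG b : exists m, G (b, m).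
  pose H : set (R^o * M)%type := [set p | G (p.1 *: b, p.2)].
  have [GZ GD GS] := sG.
  have [||m Hm] := iM H.
  - split; first by rewrite /H /= scale0r.
      by move=> [r m] [r' m'] /= Hr Hr'; rewrite /H /= scalerDl; apply: GD Hr Hr'.
    by move=> s [r m] /= Hr; rewrite /H /= -scalerA; apply: GS Hr.
  - by move=> n; rewrite /H /= scale0r; apply: uG.
  exists m.
  (* The graph extended to b by sending b to m. *)
  pose G1 : set (B * M)%type :=
    [set p | exists r x n, G (x, n) /\ p = (x + r *: b, n + r *: m)].
  have GG1 : G `<=` G1.
    by move=> [x n] Gx; exists 0, x, n; rewrite !scale0r !addr0.
  apply: (maxG G1) => //; last first.
    by exists 1, 0, 0; rewrite !scale1r !add0r.
  split; first split.
  - exact: GG1.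
  - move=> _ _ [r [x [n [Gx ->]]]] [r' [x' [n' [Gx' ->]]]].
    exists (r + r'), (x + x'), (n + n'); split; first exact: GD Gx Gx'.
    by rewrite !scalerDl !(addrACA _ _ (r *: _)).
  - move=> s _ [r [x [n [Gx ->]]]].
    exists (s * r), (s *: x), (s *: n); split; first exact: GS Gx.
    by rewrite -!scalerA -!scalerDr.
  - move=> p [r [x [n [Gx [/esym/eqP]]]]]; rewrite addrC addr_eq0 => /eqP xE ->.
    have /Hm nE : H (r, - n) by rewrite /H /= xE; apply: (submodN sG Gx).
    by rewrite -nE subrr.
have [h hE] := choice domG.
have [_ GD GS] := sG.
have h_lin : linear h.
  move=> r x y; apply: (univalentP sG uG (hE _)).
  exact: (GD _ _ (GS r _ (hE x)) (hE y)).
pose hh : {linear B -> M} := HB.pack h (GRing.isLinear.Build _ _ _ _ h h_lin).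
(* The maximal graph is total, hence the graph of a linear map. *)
exists hh => a; apply: (univalentP sG uG (hE _)); apply: G0G; by exists a.
Qed.

End Modules.

Section Submodule.
Variables (R : pzRingType) (M : lmodType R) (N : set M) (sN : submod N).

(** The proof [sN] is an argument so that the module structure can be found from
    the type alone. *)
Definition sub_module of submod N := {x : M | x \in N}.
Local Notation W := (sub_module sN).
HB.instance Definition _ := SubChoice.on W.

Fact sub_module_closed : GRing.submod_closed (fun x => x \in N).
Proof.
case: sN => N0 ND NZ; split; first exact/mem_set.
by move=> a x y /set_mem Nx /set_mem Ny; apply/mem_set/ND/Ny/NZ.
Qed.
HB.instance Definition _ :=
  @GRing.SubChoice_isSubLmodule.Build R M (fun x => x \in N) W 
    (GRing.submod_closed_semi sub_module_closed).
Definition sub_val : {linear W -> M} := val.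

Lemma sub_val_in (w : W) : N (sub_val w).
Proof. exact/set_mem/valP. Qed.

Lemma sub_val_inj : injective sub_val.
Proof. exact: val_inj. Qed.

Lemma sub_val_surj m : N m -> exists w, sub_val w = m.
Proof. by move=> Nm; exists (Sub m (mem_set Nm) : W); apply: SubK. Qed.

End Submodule.

(** The graph is itself a module, which embeds in [R] by its first projection;
    the second projection extends along this embedding. *)
Lemma injective_ideal_injective (R : pzRingType) (M : lmodType R) :
  injective_module M -> ideal_injective M.
Proof.
move=> iM G sG uG.
pose V := sub_val sG.
have fst_inj : injective (fst \o V : sub_module sG -> R^o).
  move=> v w vw; apply: (@sub_val_inj _ _ _ sG).
  move: (sub_val_in v) (sub_val_in w) vw; rewrite /comp -/V.
  case: (V v) (V w) => [r m] [r' m'] Gm Gm' /= rr'; rewrite -rr' in Gm' *.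
  by rewrite (univalentP sG uG Gm Gm').
have [h hE] := iM _ _ (fst \o V : {linear sub_module sG -> R^o}) fst_inj
                 (snd \o V : {linear sub_module sG -> M}).
exists (h 1) => r n Grn; have [w wE] := sub_val_surj sG Grn.
have : h (sub_val sG w).1 = (sub_val sG w).2 := hE w.
rewrite wE /= => <-.
by rewrite -linearZ; congr (h _); rewrite [RHS]mulr1.
Qed.

(** * Flatness of free modules *)

Section Subgroup.
Variables (T : zmodType) (N : set T).
Hypothesis N_zmod : GRing.zmod_closed (fun x => x \in N).

Definition subgroup of GRing.zmod_closed (fun x => x \in N) := {x : T | x \in N}.
Local Notation W := (subgroup N_zmod).
HB.instance Definition _ := SubChoice.on W.
HB.instance Definition _ :=
  @GRing.SubChoice_isSubZmodule.Build T (fun x => x \in N) W N_zmod.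
Definition subgroup_val : {additive W -> T} := val.

End Subgroup.

(** A tensor product is generated by pure tensors: the pairing factors through
    the subgroup [P], and by uniqueness the resulting endomorphism of [T] with
    values in [P] is the identity. *)
Lemma tensor_ind (R : pzRingType) (A : lmodType R^c) (M : lmodType R)
    (T : zmodType) (t : A -> M -> T) (P : set T) :
    is_tensor t -> P 0 -> (forall u v, P u -> P v -> P (u - v)) ->
    (forall a m, P (t a m)) ->
  forall u, P u.
Proof.
move=> [[tDl tDr tZ] tU] P0 PB Pt u.
have P_zmod : GRing.zmod_closed (fun x => x \in P).
  by split=> [|x y /set_mem Px /set_mem Py]; apply/mem_set => //; apply: PB.
pose s a m : subgroup P_zmod := Sub (t a m) (mem_set (Pt a m)).
have [|h [hE _]] := tU (subgroup P_zmod) s.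
  by split=> *; apply: val_inj; rewrite ?raddfD; [apply: tDl|apply: tDr|apply: tZ].
have [|g [gE gU]] := tU T t; first by split.
rewrite -[u]/(idfun u) (gU idfun) // -(gU (subgroup_val P_zmod \o h)).
  exact/set_mem/valP.
by move=> a m /=; rewrite hE; apply: SubK.
Qed.

(** A module with a (countable) dual basis is projective. The coordinate
    functionals [p k] act on any tensor product [A (x) M] with values in [A], and
    every tensor is recovered from its coordinates; this makes the map induced by
    an injection injective, coordinate by coordinate. *)
Section DualBasis.
Variables (R : pzRingType) (M : lmodType R).
Variables (b : nat -> M) (p : nat -> {linear M -> R^o}).
Hypothesis dual_basis : forall m : M,
  exists n0, forall n, (n0 <= n)%N -> m = \sum_(k < n) (p k m : R) *: b k.

Lemma tensor_coordinates (A : lmodType R^c) (T : zmodType) (t : A -> M -> T) :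
    is_tensor t ->
  exists phi : nat -> {additive T -> A},
    (forall k a m, phi k (t a m) = (p k m : R^c) *: a) /\
    forall u, exists n0, forall n, (n0 <= n)%N ->
      u = \sum_(k < n) t (phi k u) (b k).
Proof.
move=> tT; have [[tDl tDr tZ] tU] := tT.
have ex_phi k : exists phi : {additive T -> A},
    forall a m, phi (t a m) = (p k m : R^c) *: a.
  have [|phi [phiE _]] := tU A (fun a m => (p k m : R^c) *: a).
    split=> [a a' m|a m m'|r a m]; first by rewrite scalerDr.
      by rewrite linearD [LHS](@scalerDl R^c).
    by rewrite scalerA linearZ.
  by exists phi.
have [phi phiE] := choice ex_phi.
exists phi; split=> //.
have t0 m : t 0 m = 0 by apply: (@addrI _ (t 0 m)); rewrite -tDl !addr0.
have tN a m : t (- a) m = - t a m.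
  by apply: (@addrI _ (t a m)); rewrite -tDl !subrr.
have t_sum a (I : Type) (r : seq I) (F : I -> M) :
    t a (\sum_(i <- r) F i) = \sum_(i <- r) t a (F i).
  elim/big_rec2: _ => [|i x y _ <-]; last by rewrite tDr.
  by apply: (@addrI _ (t a 0)); rewrite -tDr !addr0.
apply: (tensor_ind tT) => [|u v [n un] [n' vn]|a m].
- by exists 0%N => n _; rewrite big1 // => k _; rewrite raddf0.
- exists (maxn n n') => l; rewrite geq_max => /andP[nl nl'].
  rewrite [in LHS](un l nl) [in LHS](vn l nl') -sumrB.
  by apply: eq_bigr => k _; rewrite raddfB tDl tN.
- have [n0 n0P] := dual_basis m; exists n0 => n n0n.
  rewrite [in LHS](n0P n n0n) t_sum; apply: eq_bigr => k _.
  by rewrite -tZ phiE.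
Qed.

Lemma dual_basis_flat : flat M.
Proof.
move=> A B f inj_f TA TB tA tB TAP TBP g gE.
have [phi [phiE phiS]] := tensor_coordinates TAP.
have [psi [psiE _]] := tensor_coordinates TBP.
have psi_g k u : f (phi k u) = psi k (g u).
  apply: (tensor_ind TAP (P := fun u => f (phi k u) = psi k (g u))).
  - by rewrite !raddf0.
  - by move=> v w vE wE; rewrite !raddfB /= vE wE.
  - by move=> a m; rewrite gE phiE psiE linearZ.
move=> u v guv; have [n nP] := phiS u; have [n' nP'] := phiS v.
rewrite (nP (maxn n n')) ?leq_maxl // (nP' (maxn n n')) ?leq_maxr //.
apply: eq_bigr => k _; congr (tA _ _); apply: inj_f.
by rewrite !psi_g guv.
Qed.

End DualBasis.

Lemma regular_flat (R : pzRingType) : @flat R R^o.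
Proof.
apply: (@dual_basis_flat R R^o (fun k => (k == 0%N)%:R) (fun _ => idfun)) => m.
exists 1%N => -[//|n _]; rewrite big_ord_recl big1 ?addr0 /= => [|i _].
  by rewrite [RHS]mulr1.
by rewrite [LHS]mulr0.
Qed.

Section FreeModule.
Variable R : pzRingType.

Definition finite_support : set (nat -> R^o) :=
  [set u | exists n, forall k, (n <= k)%N -> u k = 0].

Lemma finite_support_submod : submod finite_support.
Proof.
split; first by exists 0%N.
  move=> u v [n un] [n' vn]; exists (maxn n n') => k.
  rewrite geq_max => /andP[/un uk /vn vk].
  by rewrite -[LHS]/(u k + v k) uk vk addr0.
by move=> r u [n un]; exists n => k /un uk; rewrite -[LHS]/(r * u k) uk mulr0.
Qed.

(** The free module on countably many generators. *)
Definition free_module := sub_module finite_support_submod.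

Definition entry (k : nat) (u : free_module) : R^o := sub_val finite_support_submod u k.
Fact entry_linear k : linear (entry k).
Proof. by move=> r u v; rewrite /entry linearP. Qed.
HB.instance Definition _ k :=
  GRing.isLinear.Build R free_module R^o _ (entry k) (entry_linear k).

Lemma entryP (u v : free_module) : (forall k, entry k u = entry k v) -> u = v.
Proof. by move=> uv; apply: sub_val_inj; apply/funext. Qed.

Lemma entry_bounded (u : free_module) :
  exists n, forall k, (n <= k)%N -> entry k u = 0.
Proof. exact: (sub_val_in (sN := finite_support_submod) u). Qed.

Lemma free_moduleP (v : nat -> R) :
    (exists n, forall k, (n <= k)%N -> v k = 0) ->
  exists u : free_module, forall k, entry k u = v k.
Proof.
by move=> v0; have [u uE] := sub_val_surj finite_support_submod v0;
   exists u => k; rewrite /entry uE.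
Qed.

Lemma free_module_flat : flat free_module.
Proof.
have ex_b j : exists u : free_module, forall k, entry k u = (k == j)%:R.
  by apply: free_moduleP; exists j.+1 => k jk; rewrite gtn_eqF.
have [b bE] := choice ex_b.
apply: (@dual_basis_flat R _ b (fun k => @entry k : {linear _ -> _})) => u.
have [n0 n0P] := entry_bounded u; exists n0 => n n0n; apply: entryP => k.
rewrite linear_sum; case: (ltnP k n) => kn.
  rewrite (bigD1 (Ordinal kn)) //= linearZ /= bE eqxx [_ *: _]mulr1 big1 ?addr0 //.
  move=> i; rewrite -val_eqE /= eq_sym => /negPf ik.
  by rewrite linearZ /= bE ik [LHS]mulr0.
rewrite n0P ?(leq_trans n0n) // big1 // => i _.
by rewrite linearZ /= bE gtn_eqF ?[LHS]mulr0 // (leq_trans (ltn_ord i)).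
Qed.

End FreeModule.

(** * Annihilators *)

Definition lann (R : pzRingType) (X : set R) : set R :=
  [set r | forall x, X x -> r * x = 0].

Definition rann (R : pzRingType) (X : set R) : set R :=
  [set r | forall x, X x -> x * r = 0].

Lemma lannS (R : pzRingType) (X Y : set R) : X `<=` Y -> lann Y `<=` lann X.
Proof. by move=> XY r rY x /XY; apply: rY. Qed.

Lemma rannS (R : pzRingType) (X Y : set R) : X `<=` Y -> rann Y `<=` rann X.
Proof. by move=> XY r rY x /XY; apply: rY. Qed.

Lemma lann_ideal (R : pzRingType) (X : set R) : left_ideal (lann X).
Proof.
split=> [x _|x y xX yX z Xz|r x xX z Xz]; first by rewrite mul0r.
  by rewrite mulrDl xX ?yX ?addr0.
by rewrite -mulrA xX ?mulr0.
Qed.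

Lemma rann_ideal (R : pzRingType) (X : set R) : @left_ideal R^c (rann X).
Proof.
split=> [x _|x y xX yX z Xz|r x xX z Xz]; first by rewrite mulr0.
  by rewrite mulrDr xX ?yX ?addr0.
by change (z * ((x : R) * r) = 0); rewrite mulrA xX ?mul0r.
Qed.

Definition rann_dcc (R : pzRingType) : Prop :=
  forall X : nat -> set R, (forall n, rann (X n.+1) `<=` rann (X n)) ->
  exists n, rann (X n) `<=` rann (X n.+1).

Section Ideals.
Variable R : pzRingType.

Lemma left_idealN (I : set R) x : left_ideal I -> I x -> I (- x).
Proof. by case=> _ _ IZ Ix; rewrite -mulN1r; apply: IZ. Qed.

Lemma left_idealB (I : set R) x y : left_ideal I -> I x -> I y -> I (x - y).
Proof. by move=> lI Ix Iy; case: (lI) => _ ID _; apply: ID => //; apply: left_idealN. Qed.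

Lemma lann_rann (X : set R) : X `<=` lann (rann X).
Proof. by move=> x Xx y; apply. Qed.

Lemma rann_lann (X : set R) : X `<=` rann (lann X).
Proof. by move=> x Xx y; apply. Qed.

Lemma lannK (X : set R) : lann (rann (lann X)) = lann X.
Proof.
apply/seteqP; split=> y yX x Xx; last exact: Xx.
by apply: yX => z; apply.
Qed.

Lemma decreasing_chain (W : nat -> set R) : (forall n, W n.+1 `<=` W n) ->
  forall m n, (m <= n)%N -> W n `<=` W m.
Proof.
move=> decW m n; elim: n => [|n IH]; first by rewrite leqn0 => /eqP ->.
by rewrite leq_eqVlt => /predU1P[-> //|/IH]; apply: subset_trans.
Qed.

End Ideals.

(** * What semi-compactness of free modules gives *)

(** Let [G] be the graph of a homomorphism [f] from a left ideal. A multiplier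
    for [f] is a common solution of the conditions [a * y = f a], each of which is
    a congruence modulo the annihilator of [R a]. Finitely many of them concern a
    finitely generated left ideal, where semi-injectivity gives a solution. *)
Lemma semi_compact_self_injective (R : pzRingType) :
    self_left_semi_injective R -> @semi_compact R R^o ->
  @ideal_injective R R^o.
Proof.
move=> fR cR G sG uG; have [G0 GD GZ] := sG.
have finite_sol (s : seq (R * R)) : exists y : R,
    forall p, p \in s -> G p -> p.2 = p.1 * y.
  pose s' := [seq p <- s | `[< G p >]].
  pose a (i : 'I_(size s')) := (nth 0 s' i).1.
  pose e (i : 'I_(size s')) := (nth 0 s' i).2.
  have Gs' i : G (a i, e i).
    have := mem_nth 0 (ltn_ord i); rewrite mem_filter => /andP[/asboolP + _].
    by rewrite /a /e -surjective_pairing.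
  pose I := [set x | exists c : 'I_(size s') -> R, x = \sum_i c i * a i].
  have domI x : exists y, I x -> G (x, y).
    have [[c ->]|nIx] := pselect (I x); last by exists 0.
    exists (\sum_i c i * e i) => _.
    elim/big_rec2: _ => // i x1 x2 _ Gx.
    exact: (GD (_, _) (_, _) (GZ (c i) (_, _) (Gs' i)) Gx).
  have [f fE] := choice domI.
  have I_ideal : left_ideal I.
    split.
    - by exists (fun=> 0); rewrite big1 // => i _; rewrite mul0r.
    - move=> _ _ [c ->] [d ->]; exists (fun i => c i + d i).
      by rewrite -big_split; apply: eq_bigr => i _; rewrite mulrDl.
    - move=> r _ [c ->]; exists (fun i => r * c i).
      by rewrite mulr_sumr; apply: eq_bigr => i _; rewrite mulrA.
  have [_ ID IZ] := I_ideal.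
  have [||g gE] := fR I _ f.
  - by exists (size s'), a.
  - split=> [x y Ix Iy|r x Ix]; apply: (univalentP sG uG (fE _ _)).
    + exact: ID.
    + exact: (GD (_, _) (_, _) (fE _ Ix) (fE _ Iy)).
    + exact: IZ.
    + exact: (GZ r (_, _) (fE _ Ix)).
  exists (g 1) => -[r y] ps Gp /=.
  have Ir : I r.
    have ss' : (r, y) \in s' by rewrite mem_filter ps andbT; apply/asboolP.
    have lt_i : (index (r, y) s' < size s')%N by rewrite index_mem.
    exists (fun i => (i == Ordinal lt_i)%:R).
    rewrite (bigD1 (Ordinal lt_i)) //= eqxx mul1r big1 ?addr0 => [|i /negPf ->].
      by rewrite /a /= nth_index.
    by rewrite mul0r.
  rewrite (univalentP sG uG Gp (fE r Ir)) -gE //.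
  by rewrite -[r * g 1]/(r *: g 1) -linearZ; congr (g _); rewrite [RHS]mulr1.
have ex_x0 (p : R * R) : exists y : R, G p -> p.2 = p.1 * y.
  by have [y yP] := finite_sol [:: p]; exists y; apply: yP; rewrite inE.
have [x0 x0P] := choice ex_x0.
(* A pair outside the graph gets the zero ideal, so imposes no condition. *)
pose J (p : R * R) := [set x : R | exists r, x = r * p.1 /\ (G p \/ r = 0)].
have [||y yP] := cR _ x0 J.
- move=> p; split; first by exists 0; rewrite mul0r; split=> //; right.
    move=> _ _ [r [-> Gr]] [r' [-> Gr']]; exists (r + r'); rewrite mulrDl; split=> //.
    case: Gr => [|->]; first by left.
    by case: Gr' => [|->]; [left|right; rewrite addr0].
  move=> s _ [r [-> Gr]]; exists (s * r); rewrite mulrA; split=> //.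
  by case: Gr => [|->]; [left|right; rewrite mulr0].
- move=> F /finite_seqP[s ->]; have [y yP] := finite_sol s; exists y => p /= ps.
  move=> _ [r [-> [Gp|->]]]; last by rewrite mul0r scale0r.
  change ((r * p.1) * (y - x0 p) = 0).
  by rewrite -mulrA mulrBr -yP // -x0P // subrr mulr0.
exists y => r n Grn; apply/esym/eqP; have /= -> := x0P _ Grn.
change (r * y == r * x0 (r, n)); rewrite -subr_eq0 -mulrBr.
by apply/eqP/(yP (r, n)); exists 1; rewrite mul1r; split=> //; left.
Qed.

(** If the right annihilators strictly decrease, pick [y n] in the [n]-th but not
    in the next. The congruences satisfied by the sequence of all [y n] modulo
    the double annihilators are finitely solvable by truncation, but a solution
    of finite support would put some [y m] in the wrong annihilator. *)
Lemma semi_compact_rann_dcc (R : pzRingType) :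
  semi_compact (free_module R) -> rann_dcc R.
Proof.
move=> cF X decX; apply: contrapT => strict.
have decX' := decreasing_chain decX.
have ex_y n : exists y, rann (X n) y /\ ~ rann (X n.+1) y.
  apply: contrapT => ny; apply: strict; exists n => y Xy.
  by apply: contrapT => nXy; apply: ny; exists y.
have [y yP] := choice ex_y.
have ex_x n : exists u : free_module R,
    forall k, entry k u = if (k < n)%N then y k else 0.
  by apply: free_moduleP; exists n => k; rewrite ltnNge => ->.
(* x n is the sequence y 0, ..., y (n - 1), 0, 0, ...; no sequence of finite
   support agrees with all of them modulo the annihilated submodules. *)
have [x xE] := choice ex_x.
have [||z zP] := cF nat x (fun n => lann (rann (X n))).
- by move=> n; apply: lann_ideal.
- move=> F /finite_seqP[s ->]; exists (x (\max_(n <- s) n)%N) => n /= ns r rn.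
  apply: entryP => k; rewrite linearZ linearB /= !xE linear0.
  have n_max : (n <= \max_(n <- s) n)%N by apply: leq_bigmax_seq.
  case: (ltnP k n) => kn; first by rewrite (leq_trans kn) // subrr scaler0.
  rewrite subr0; case: ifP => _; last by rewrite scaler0.
  by apply: rn; apply: (decX' n k kn); case: (yP k).
- have [m z0] := entry_bounded z.
  case: (yP m) => ym; apply=> r Xr.
  have := zP m.+1 r; rewrite /annihilated /= => /(_ _)/(congr1 (entry m)).
  rewrite linearZ linearB /= xE ltnSn z0 // sub0r linear0 => zr.
  apply/eqP; rewrite -oppr_eq0 -mulrN; apply/eqP; apply: zr.
  by move=> v; apply.
Qed.

(** * Essential extensions inside a self-injective ring *)

Section SelfInjective.
Variables (R : pzRingType) (injR : @ideal_injective R R^o).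

(** [ideal_injective] for the regular module, with the graph as a relation. *)
Lemma extend_relation (G : R -> R -> Prop) :
    G 0 0 -> (forall x x' y y', G x y -> G x' y' -> G (x + x') (y + y')) ->
    (forall r x y, G x y -> G (r * x) (r * y)) -> (forall y, G 0 y -> y = 0) ->
  exists c, forall x y, G x y -> y = x * c.
Proof.
move=> G0 GD GZ Gu.
have [||c cP] := injR (G := fun p => G p.1 p.2).
- by split=> // [[x y] [x' y'] /=|r [x y] /=]; [apply: GD|apply: GZ].
- by move=> y; apply: Gu.
by exists c => x y; apply: (cP x y).
Qed.

(** The map [R a -> R b] sending [a] to [b] is well defined, so it is a right
    multiplication. *)
Lemma principal_extension (a b : R) :
  (forall r, r * a = 0 -> r * b = 0) -> exists c, b = a * c.
Proof.
move=> ab; pose G x y := exists r, x = r * a /\ y = r * b.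
have [||||c cP] := extend_relation (G := G).
- by exists 0; rewrite !mul0r.
- by move=> _ _ _ _ [r [-> ->]] [r' [-> ->]]; exists (r + r'); rewrite !mulrDl.
- by move=> s _ _ [r [-> ->]]; exists (s * r); rewrite !mulrA.
- by move=> _ [r [/esym/ab rb ->]].
by exists c; apply: cP; exists 1; rewrite !mul1r.
Qed.

Lemma disjoint_maximal (L K : set R) :
    left_ideal L -> (forall x, L x -> K x -> x = 0) ->
  exists E, [/\ left_ideal E, L `<=` E, (forall x, E x -> K x -> x = 0) &
    forall E', left_ideal E' -> (forall x, E' x -> K x -> x = 0) ->
    E `<=` E' -> E' `<=` E].
Proof.
move=> lL LK.
have [||E [[lE EK] LE maxE]] := @maximal_above _
    (fun E => left_ideal E /\ forall x, E x -> K x -> x = 0) L.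
- by [].
- move=> F F0 Fgood Ftot; split.
    by apply: (@submod_bigcup R R^o) => // X /Fgood[].
  by move=> x [X /Fgood[_ XK] Xx]; apply: XK.
by exists E; split=> // E' lE' E'K; apply: maxE.
Qed.

(** The injective hull of [L] inside [R] is a direct summand [R e]. With [K]
    maximal among the left ideals disjoint from [L], and [E] maximal among those
    containing [L] and disjoint from [K], the projection of [E + K] onto [E]
    extends to right multiplication by some [c]. Maximality of [K] makes [L]
    essential in [R c], and maximality of [E] gives [R c = E], so that [c] is
    idempotent. *)
Lemma idempotent_hull (L : set R) : left_ideal L ->
  exists e, [/\ e * e = e, forall x, L x -> x * e = x &
    forall x, x * e != 0 -> exists r, r * (x * e) != 0 /\ L (r * (x * e))].
Proof.
move=> lL; have [L0 LD LZ] := lL.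
have [||K [lK _ KL maxK]] := @disjoint_maximal [set 0] L.
- by split=> [//|x y -> ->|r x ->]; rewrite ?addr0 ?mulr0.
- by move=> x ->.
have [//||E [lE LE EK maxE]] := @disjoint_maximal L K.
  by move=> x Lx Kx; apply: KL.
have [K0 KD KZ] := lK; have [E0 ED EZ] := lE.
(* The projection of E + K onto E along K. *)
pose G x y := E y /\ K (x - y).
have [||||c cP] := extend_relation (G := G).
- by split; rewrite ?subrr.
- move=> x x' y y' [Ey Kxy] [Ey' Kxy']; split; first exact: ED.
  by rewrite opprD addrACA; apply: KD.
- by move=> r x y [Ey Kxy]; split; [apply: EZ|rewrite -mulrBr; apply: KZ].
- move=> y [Ey Ky]; apply: EK => //.
  by rewrite sub0r in Ky; rewrite -[y]opprK; apply: left_idealN.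
have cE x : E x -> x * c = x by move=> Ex; rewrite -(cP x x) //; split; rewrite ?subrr.
have cK x : K x -> x * c = 0 by move=> Kx; rewrite -(cP x 0) //; split; rewrite ?subr0.
have ess x : x * c != 0 -> exists r, r * (x * c) != 0 /\ L (r * (x * c)).
  move=> xc; pose K' := [set y | exists k r, K k /\ y = k + r * x].
  have [|nmeet] := pselect (exists y, [/\ K' y, L y & y != 0]).
    move=> [y [[k [r [Kk yE]] Ly y0]]]; exists r.
    have <- : y = r * (x * c).
      by rewrite -[LHS](cE y (LE y Ly)) {1}yE mulrDl cK // add0r mulrA.
    by [].
  have K'K : K' `<=` K.
    apply: maxK.
    - split; first by exists 0, 0; rewrite mul0r addr0.
        move=> _ _ [k [r [Kk ->]]] [k' [r' [Kk' ->]]].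
        by exists (k + k'), (r + r'); rewrite mulrDl addrACA; split=> //; apply: KD.
      move=> s _ [k [r [Kk ->]]]; exists (s * k), (s * r).
      by rewrite mulrDr mulrA; split=> //; apply: KZ.
    - move=> y K'y Ly; apply/eqP; apply: contra_notT nmeet => y0; by exists y.
    - by move=> k Kk; exists k, 0; rewrite mul0r addr0.
  case/eqP: xc; apply/cK/K'K; by exists 0, 1; rewrite mul1r add0r.
have cc : c * c = c.
  apply: (cE c); apply: (maxE [set y | exists x, y = x * c]);
    last by exists 1; rewrite mul1r.
  - split; first by exists 0; rewrite mul0r.
      by move=> _ _ [x ->] [y ->]; exists (x + y); rewrite mulrDl.
    by move=> r _ [x ->]; exists (r * x); rewrite mulrA.
  - move=> _ [x ->] Kxc; apply/eqP; apply: contraT => /ess[r [+ Lr]].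
    by rewrite (KL _ _ Lr) ?eqxx //; apply: KZ.
  - by move=> x /cE <-; exists x.
by exists c; split=> // x Lx; apply/cE/LE.
Qed.

End SelfInjective.

(** * The left singular ideal *)

Section Singular.
Variable R : pzRingType.

(** The left annihilator of [x] is an essential left ideal. In a quasi-Frobenius
    ring the singular elements form the Jacobson radical, and the ideal plays
    that role below. *)
Definition singular (x : R) : Prop :=
  forall y, y != 0 -> exists r, r * y != 0 /\ r * y * x = 0.

Lemma singular0 : singular 0.
Proof. by move=> y y0; exists 1; rewrite mul1r mulr0. Qed.

Lemma singularD x x' : singular x -> singular x' -> singular (x + x').
Proof.
move=> sx sx' y /sx[r [/sx'[s [sry sryx']] ryx]]; exists (s * r).
by rewrite -mulrA mulrDr sryx' addr0 -(mulrA s) ryx mulr0.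
Qed.

Lemma singularMr x c : singular x -> singular (x * c).
Proof. by move=> sx y /sx[r [ry ryx]]; exists r; rewrite mulrA ryx mul0r. Qed.

(** [y * c] in place of [y] reduces this to the singularity of [x], unless
    [y * c] vanishes. *)
Lemma singularMl c x : singular x -> singular (c * x).
Proof.
move=> sx y y0; have [yc0|] := eqVneq (y * c) 0.
  by exists 1; rewrite mul1r mulrA yc0 mul0r.
move=> /sx[r [ryc rycx]]; exists r; split; last by rewrite mulrA -(mulrA r).
by apply: contraNneq ryc => ry; rewrite mulrA ry mul0r.
Qed.

Lemma singular_ideal : left_ideal singular.
Proof. by split; [exact: singular0|exact: singularD|exact: singularMl]. Qed.

Lemma singular_sym x y : singular (x - y) -> singular (y - x).
Proof. by rewrite -(opprB x y); apply: left_idealN singular_ideal. Qed.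

Lemma singular_trans y x z :
  singular (x - y) -> singular (y - z) -> singular (x - z).
Proof. by move=> xy yz; rewrite -(subrKA y x (- z)); apply: singularD. Qed.

Lemma singular_cong x y : singular (x - y) -> singular y -> singular x.
Proof. by move=> xy sy; rewrite -(subrK y x); apply: singularD. Qed.

End Singular.

Section Radical.
Variables (R : pzRingType) (injR : @ideal_injective R R^o).
Hypothesis dccR : rann_dcc R.

Lemma rann_minimal (T : Type) (P : T -> Prop) (f : T -> set R) t0 : P t0 ->
  exists t, P t /\
    forall t', P t' -> rann (f t') `<=` rann (f t) -> rann (f t) `<=` rann (f t').
Proof.
by apply: minimal_member => t _ tS; apply: (dccR (X := f \o t)) tS.
Qed.

(** Up to a singular element, [x] is [f * x], and right multiplication by [x] is
    an isomorphism of [R f] onto its image; its inverse extends to right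
    multiplication by [y]. *)
Lemma idempotent_part (x : R) : exists f y,
  [/\ f * f = f, singular (x - f * x) & f * x * y = f].
Proof.
(* R e is an essential extension of the left annihilator of x, so x is
   injective on the complementary summand R f. *)
have [e [ee le ess]] := idempotent_hull injR (lann_ideal [set x]).
pose f := 1 - e.
have [y fE] : exists y, f = f * x * y.
  apply: principal_extension => // r; rewrite mulrA => rfx.
  have /le : lann [set x] (r * f) by move=> _ ->.
  by rewrite /f -mulrA mulrBl mul1r ee subrr mulr0 => <-.
exists f, y; split=> //.
  by rewrite /f mulrBl mul1r mulrBr mulr1 ee subrr subr0.
have -> : x - f * x = e * x by rewrite /f mulrBl mul1r subKr.
move=> z z0; have [ze|/ess[r [rze lr]]] := eqVneq (z * e) 0.
  by exists 1; rewrite mul1r mulrA ze mul0r.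
exists r; split; first by apply: contraNneq rze => rz; rewrite mulrA rz mul0r.
by rewrite -(lr x) // !mulrA.
Qed.

(** Von Neumann regularity modulo the singular ideal: modulo it [x] is [f * x],
    and [f * x * y * f * x] is [f * x]. *)
Lemma regular_mod_singular (x : R) : exists y, singular (x - x * y * x).
Proof.
have [f [y [ff sx fxy]]] := idempotent_part x; exists y.
have fxE : f * x = f * x * y * f * x by rewrite fxy ff.
apply: (singular_trans sx); rewrite fxE.
apply: (@singular_trans _ (x * y * f * x)).
  by rewrite -!mulrBl; do 3!apply: singularMr; apply: singular_sym.
by rewrite -mulrA -mulrBr; apply/singularMl/singular_sym.
Qed.

Fixpoint singular_products n : set R :=
  if n is n'.+1 then
    [set v | exists z w, [/\ singular z, singular_products n' w & v = z * w]]
  else [set 1].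

Lemma singular_productsSr n v : singular_products n.+1 v ->
  exists w z, singular_products n w /\ v = w * z.
Proof.
elim: n v => [|n IH] v /= [z [w [sz pw ->]]].
  by exists 1, z; rewrite pw mulr1 mul1r.
have [w' [z' [pw' ->]]] := IH w pw; exists (z * w'), z'.
by split; [exists z, w'|rewrite mulrA].
Qed.

(** The left annihilators of the powers of the singular ideal increase, so the
    one of some power [n] equals the next. If it is proper, take [a] outside it
    with a maximal left annihilator. For singular [z], some nonzero multiple of
    [a] is killed by [z], so [a * z] has a larger left annihilator and lies in the
    left annihilator of power [n]; hence [a] lies in that of power [n + 1],
    which is the same. *)
Lemma singular_nilpotent : exists n, forall v, singular_products n v -> v = 0.
Proof.
have [|n ln] := dccR (X := fun n => lann (singular_products n)).
  move=> n; apply: rannS => x lx _ /singular_productsSr[w [z [pw ->]]].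
  by rewrite mulrA lx ?mul0r.
have {}ln : lann (singular_products n.+1) `<=` lann (singular_products n).
  by move=> x /lann_rann /(lannS ln); rewrite lannK.
exists n; apply: contrapT => nil_n.
have [|a [na amin]] := @rann_minimal R
    (fun a => ~ lann (singular_products n) a) (fun a => lann [set a]) 1.
  by move=> l1; apply: nil_n => v /l1; rewrite mul1r.
apply: (na); apply: ln => _ [z [w [sz pw ->]]]; rewrite mulrA.
suff : lann (singular_products n) (a * z) by apply.
apply: contrapT => naz.
have [|r [ra raz]] := sz a.
  by apply: contra_notN na => /eqP -> v _; rewrite mul0r.
have az : rann (lann [set a]) `<=` rann (lann [set a * z]).
  by apply: amin => //; apply: rannS => s sa _ ->; rewrite mulrA sa ?mul0r.
case/eqP: ra.
have : lann (rann (lann [set a])) r.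
  by apply: (lannS az); rewrite lannK => _ ->; rewrite mulrA.
by rewrite lannK; apply.
Qed.

(** Multiply 1 by singular elements as long as the product stays outside [I]. *)
Lemma killed_mod_ideal (I : set R) : left_ideal I -> ~ I 1 ->
  exists x, ~ I x /\ forall z, singular z -> I (z * x).
Proof.
move=> [I0 _ _] nI1; apply: contrapT => nox; have [n nil] := singular_nilpotent.
have [w [pw nIw]] : exists w, singular_products n w /\ ~ I w.
  elim: n {nil} => [|n [w [pw nIw]]]; first by exists 1.
  apply: contrapT => now; apply: nox; exists w; split=> // z sz.
  by apply: contrapT => nIzw; apply: now; exists (z * w); split=> //; exists z, w.
by apply: nIw; rewrite (nil w).
Qed.

(** The ring is semisimple modulo its singular ideal. Choose [g] idempotent in
    [Q] with the smallest right annihilator. A nonsingular [x - x * g] would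
    provide an idempotent [h] of [Q] with [h * g = 0], and [R g + R h] would have
    an idempotent generator with a smaller right annihilator. *)
Lemma idempotent_generator (Q : set R) : left_ideal Q -> @singular R `<=` Q ->
  exists g, [/\ g * g = g, Q g & forall x, Q x -> singular (x - x * g)].
Proof.
move=> [Q0 QD QZ] sQ; have lQ : left_ideal Q by [].
have [|g [[gg Qg] gmin]] := @rann_minimal R
    (fun g => g * g = g /\ Q g) (fun g => [set g]) 0.
  by rewrite mul0r.
exists g; split=> // x Qx.
pose x' := x - x * g.
have Qx' : Q x' by apply: left_idealB => //; apply: QZ.
have x'g : x' * g = 0 by rewrite mulrBl -mulrA gg subrr.
have [f [y [ff sx' fxy]]] := idempotent_part x'.
(* h generates R x' modulo the singular ideal, and h g = 0 holds exactly. *)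
pose h := y * (f * x').
have hh : h * h = h.
  by rewrite /h -mulrA (mulrA (f * x')) fxy (mulrA f) ff.
have hg : h * g = 0 by rewrite /h -!mulrA x'g !mulr0.
have Qh : Q h.
  apply: QZ; rewrite -(subKr x' (f * x')); apply: left_idealB => //; exact: sQ.
have gh : g * h = h.
  apply/esym/eqP; rewrite -subr_eq0; apply/eqP.
  (* R k = R g + R h, so minimality of g forces k and g to have the same right
     annihilator, which contains h - g h. *)
  pose k := g + (h - g * h).
  have kg : k * g = g by rewrite /k mulrDl gg mulrBl hg -mulrA hg mulr0 subrr addr0.
  have kh : k * h = h by rewrite /k mulrDl mulrBl hh -mulrA hh addrC subrK.
  have kk : k * k = k by rewrite {2}/k mulrDr kg mulrBr kh mulrA kg.
  have gk : g * k = g by rewrite /k mulrDr mulrBr mulrA gg subrr addr0.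
  have Qk : Q k by apply: QD => //; apply: left_idealB => //; apply: QZ.
  have kg_sub : rann [set k] `<=` rann [set g].
    by move=> v kv _ ->; rewrite -gk -mulrA kv ?mulr0.
  have : rann [set k] (h - g * h).
    by apply: (gmin k (conj kk Qk) kg_sub) => _ ->; rewrite mulrBr mulrA gg subrr.
  by move=> /(_ k erefl); rewrite mulrBr mulrA kg kh.
have h0 : h = 0 by rewrite -hh -{2}gh mulrA hg mul0r.
have : f * x' = 0 by rewrite -ff -{1}fxy -!mulrA -/h h0 !mulr0.
by move=> fx0; rewrite fx0 subr0 in sx'.
Qed.

End Radical.

(** * The left socle and double annihilators of left ideals *)

Section Socle.
Variables (R : pzRingType) (injR : @ideal_injective R R^o).
Hypothesis dccR : rann_dcc R.

(** By semisimplicity modulo the singular ideal, the elements killed by it on the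
    left form the left socle. *)
Definition socle : set R := rann (@singular R).

Lemma socleMl r s : socle s -> socle (r * s).
Proof. by move=> Ss z sz; rewrite mulrA; apply/Ss/singularMr. Qed.

(** The left ideal generated by [s] is semisimple, and the left annihilator of
    [x] meets it in an essential, hence improper, submodule. *)
Lemma socle_singular s x : socle s -> singular x -> s * x = 0.
Proof.
move=> Ss sx; pose Q := lann [set s * x].
have [||g [gg Qg gQ]] := idempotent_generator injR dccR (Q := Q).
- exact: lann_ideal.
- by move=> z sz _ ->; rewrite mulrA Ss ?mul0r.
have [gs|/sx[r [+ rsx]]] := eqVneq ((1 - g) * s) 0.
  have -> : s = g * s.
    apply/esym/eqP; rewrite -subr_eq0 -opprB.
    by rewrite -{1}[s]mul1r -mulrBl gs oppr0.
  by rewrite -mulrA; apply: Qg.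
rewrite mulrA Ss ?eqxx // mulrBr mulr1.
have Qr : Q (r * (1 - g)) by move=> _ ->; rewrite -rsx !mulrA.
by have := gQ _ Qr; rewrite mulrBr mulr1 mulrBl -mulrA gg subrr subr0.
Qed.

(** By nilpotency of the singular ideal, the socle is an essential left ideal, so
    an [x] annihilated by it is singular by definition. *)
Lemma rann_socle x : (forall s, socle s -> s * x = 0) -> singular x.
Proof.
move=> Sx y y0; have [I0 ID IZ] := lann_ideal [set y].
have [||r [nry zry]] := killed_mod_ideal dccR (I := lann [set y]).
- exact: lann_ideal.
- by move=> /(_ y erefl); rewrite mul1r; apply/eqP.
exists r; split; first by apply: contra_notN nry => /eqP ry _ ->.
by apply: Sx => z /zry /(_ y erefl); rewrite mulrA.
Qed.

Definition mul_closed (C : set R) : Prop := forall a x b, C x -> C (a * x * b).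

(** Suppose for illustration that [R] modulo its singular ideal is the product of
    the simple blocks [B i]. Each indecomposable injective [R e] has a simple
    socle, whose type depends only on the top of [R e]; this defines a map [pi]
    on blocks. If [C] is the ideal of the blocks in a set [U], the left annihilator
    [socle_killer C] of [socle * C] consists of the blocks outside [pi U], and
    [next_ideal C] is the ideal of the blocks in [pi U]. The three lemmas
    [next_disjoint], [next_singular] and [lann_socle] say that [pi] is injective,
    preserves nonemptiness and is therefore onto, without choosing idempotents. *)
Definition socle_killer (C : set R) : set R :=
  [set r | forall s c, socle s -> C c -> r * s * c = 0].

Definition next_ideal (C : set R) : set R :=
  [set x | forall r, socle_killer C r -> singular (r * x)].

Lemma killer_ideal C : left_ideal (socle_killer C).
Proof.
split=> [s c _ _|x y xC yC s c Ss Cc|r x xC s c Ss Cc]; first by rewrite !mul0r.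
  by rewrite !mulrDl xC ?yC ?addr0.
by rewrite -!mulrA (mulrA x) xC ?mulr0.
Qed.

Lemma singular_killer C : @singular R `<=` socle_killer C.
Proof. by move=> z sz s c Ss _; rewrite Ss ?mul0r. Qed.

Lemma next_closed C : mul_closed (next_ideal C).
Proof.
move=> a x b Cx r kr; rewrite !mulrA; apply: singularMr; apply: Cx => s c Ss Cc.
by rewrite -(mulrA r); apply: kr => //; apply: socleMl.
Qed.

Lemma singular_square (x y : R) :
  singular (x - x * y * x) -> singular (x * (y * x)) -> singular x.
Proof. by rewrite mulrA; apply: singular_cong. Qed.

Lemma next_killer C u : next_ideal C u -> socle_killer C u -> singular u.
Proof.
move=> Cu ku; have [y uyu] := regular_mod_singular injR u.
by apply: singular_square uyu _; rewrite -[_ * u]mulr1; apply: (next_closed y 1 Cu).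
Qed.

(** If [u] were not singular, nonzero products [v * s * c] and [v * s' * d] with
    [c] in [C], [d] in [D] could be found such that the left annihilator of the
    first kills the second, making the second a right multiple of the first. It
    then lies in the part of the socle belonging to both [C] and [D], which is
    zero. *)
Lemma next_disjoint C D : mul_closed C -> mul_closed D ->
    (forall x, C x -> D x -> singular x) ->
  forall u, next_ideal C u -> next_ideal D u -> singular u.
Proof.
move=> mC mD CD u Cu Du; apply: contrapT => nu.
have not_killed E v : next_ideal E v -> ~ singular v ->
    exists s e, [/\ socle s, E e & v * s * e <> 0].
  move=> Ev nv; apply: contrapT => none; apply: nv.
  apply: next_killer Ev _ => s e Ss Ee.
  by apply: contrapT => vse; apply: none; exists s, e.
have [s [c [Ss Cc usc]]] := not_killed C u Cu nu.
pose Q := lann [set u * s * c].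
have [||g [gg Qg gQ]] := idempotent_generator injR dccR (Q := Q).
- exact: lann_ideal.
- by move=> z sz _ ->; rewrite mulrA (socleMl u Ss) ?mul0r.
(* Replacing u by v keeps u s c, and makes every left annihilator of u s c an
   annihilator of v s' d as well. *)
pose v := (1 - g) * u.
have vsc : v * s * c = u * s * c.
  by rewrite /v -!mulrA mulrBl mul1r [u * _]mulrA Qg // subr0.
have [||s' [d [Ss' Dd vsd]]] := not_killed D v.
- by rewrite /v -[_ * u]mulr1; apply: next_closed.
- by move=> sv; apply: usc; rewrite -vsc Ss ?mul0r.
have [b usb] : exists b, v * s' * d = u * s * c * b.
  apply: (principal_extension injR) => r rusc.
  have Qr : Q r by move=> _ ->.
  have := socleMl u Ss' (gQ r Qr).
  by rewrite -[r - r * g]/(r - r * g) -{1}[r]mulr1 -mulrBr /v !mulrA => ->; rewrite mul0r.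
have [y dyd] := regular_mod_singular injR d.
apply: vsd.
have -> : v * s' * d = v * s' * (d * y * d).
  apply/eqP; rewrite -subr_eq0 -mulrBr; apply/eqP.
  exact/socle_singular/dyd/socleMl.
rewrite !mulrA usb -!mulrA mulrA; apply: socle_singular; first exact: socleMl.
rewrite mulrA; apply: CD; last by rewrite -[_ * (y * d)]mulr1 !mulrA; apply: mD.
by rewrite -[c]mul1r -!mulrA mulrA; apply: mC.
Qed.

(** If [socle_killer C] is generated by the idempotent [g] modulo singular
    elements, then [1 - g] is in [next_ideal C]. *)
Lemma next_singular C : next_ideal C `<=` @singular R -> C `<=` @singular R.
Proof.
move=> nC c Cc.
have [||g [gg kg gk]] := idempotent_generator injR dccR (Q := socle_killer C).
- exact: killer_ideal.
- exact: singular_killer.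
have [_ kD _] := killer_ideal C.
have s1g : singular (1 - g) by apply: nC => r /gk; rewrite mulrBr mulr1.
have k1 : socle_killer C 1 by rewrite -(subrK g 1); apply: kD kg; apply: singular_killer.
by apply: rann_socle => s Ss; rewrite -[s]mul1r; apply: k1.
Qed.

(** Every simple left module embeds in the ring. The ideals obtained by iterating
    [next_ideal] from the left annihilator of the socle are pairwise disjoint
    modulo the singular ideal, as a block outside the image of an injective map
    has pairwise distinct iterates. If the first were not contained in the
    singular ideal, none would be, against the chain condition. *)
Lemma lann_socle : lann socle `<=` @singular R.
Proof.
pose C k := iter k next_ideal (lann socle).
have mC k : mul_closed (C k).
  case: k => [|k]; last exact: next_closed.
  move=> a x b lx s Ss; rewrite -!mulrA lx ?mulr0 //; exact: socleMl.
have disj0 k x : C 0%N x -> C k.+1 x -> singular x.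
  move=> C0x; move=> /next_killer; apply=> s c Ss _.
  by rewrite C0x ?mul0r.
have disj i j : (i < j)%N -> forall x, C i x -> C j x -> singular x.
  elim: i j => [|i IH] [//|j]; first by move=> _; apply: disj0.
  by move=> ij; apply: next_disjoint => //; apply: IH.
apply: contrapT => n0.
have nC k : ~ C k `<=` @singular R.
  by elim: k => // k IH /next_singular.
(* Since the C j are pairwise disjoint modulo the singular ideal, C k is in the
   right annihilator of W k, but it annihilates its own multiples in W (k + 1)
   only if it is singular. *)
pose W k := [set t | exists j s c, [/\ (j < k)%N, socle s, C j c & t = s * c]].
have [k|k Wk] := dccR (X := W).
  apply: rannS => _ [j [s [c [jk Ss Cc ->]]]]; exists j, s, c; split=> //.
  exact: ltnW.
apply: (nC k) => x Ckx.
have [y xyx] := regular_mod_singular injR x.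
apply: singular_square xyx _; apply: rann_socle => s Ss.
have Wx : rann (W k) x.
  move=> _ [j [s' [c [jk Ss' Cc ->]]]]; rewrite -mulrA; apply: socle_singular => //.
  apply: (disj j k jk); last by rewrite -[_ * _]mulr1; apply: mC.
  by rewrite -[c]mul1r; apply: mC.
rewrite !mulrA -(mulrA s); apply: (Wk x Wx).
exists k, s, (x * y); split=> //; rewrite -[x]mul1r; exact: mC.
Qed.

(** For [b] outside [I], some multiple [a] of [b] is outside [I] with [I + R a]
    killed modulo [I] by the singular ideal; as simple modules embed in the ring,
    a homomorphism from [I + R a] to [R] kills [I] but not [a]. It is a right
    multiplication by an element of the right annihilator of [I]. *)
Lemma left_double_annihilator (I : set R) : left_ideal I -> lann (rann I) = I.
Proof.
move=> lI; have [I0 ID IZ] := lI.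
apply/seteqP; split; last exact: lann_rann.
move=> b lb; apply: contrapT => nIb.
have [||x [nIxb zIxb]] := killed_mod_ideal dccR (I := [set r | I (r * b)]).
- split=> /= [|r s|r s]; first by rewrite mul0r.
    by rewrite mulrDl; apply: ID.
  by rewrite -mulrA; apply: IZ.
- by rewrite /= mul1r.
pose a := x * b.
pose Q := [set r | I (r * a)].
have [||g [gg Qg gQ]] := idempotent_generator injR dccR (Q := Q).
- split=> /= [|r s|r s]; rewrite /Q /= ?mul0r //.
    by rewrite mulrDl; apply: ID.
  by rewrite -mulrA; apply: IZ.
- by move=> z sz; rewrite /Q /= mulrA; apply: zIxb.
have [s [Ss gs]] : exists s, socle s /\ (1 - g) * s <> 0.
  apply: contrapT => nos; apply: nIxb => /=; rewrite -/a.
  have : Q (1 - g).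
    have /lann_socle : lann socle (1 - g).
      by move=> s Ss; apply: contrapT => gs; apply: nos; exists s.
    by move=> sg; rewrite /Q /= /a mulrA; apply: zIxb.
  by move=> /(ID _ _ Qg); rewrite -mulrDl addrC subrK mul1r.
(* The map I + R a -> R that kills I and sends a to (1 - g) s. *)
pose G u v := exists i r, [/\ I i, u = i + r * a & v = r * ((1 - g) * s)].
have [||||c cP] := extend_relation injR (G := G).
- by exists 0, 0; rewrite !mul0r addr0.
- move=> _ _ _ _ [i [r [Ii -> ->]]] [i' [r' [Ii' -> ->]]].
  by exists (i + i'), (r + r'); rewrite addrACA !mulrDl; split=> //; apply: ID.
- move=> t _ _ [i [r [Ii -> ->]]]; exists (t * i), (t * r).
  by rewrite mulrDr !mulrA; split=> //; apply: IZ.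
- move=> _ [i [r [Ii /esym/eqP + ->]]]; rewrite addrC addr_eq0 => /eqP ra.
  have Qr : Q r by rewrite /Q /= ra; apply: left_idealN.
  by rewrite mulrA Ss // mulrBr mulr1; apply: gQ.
have Ic : rann I c.
  by move=> i Ii; rewrite -(cP i 0) //; exists i, 0; rewrite !mul0r addr0.
apply: gs; rewrite (cP a ((1 - g) * s)); last by exists 0, 1; rewrite !mul1r add0r.
by rewrite /a -mulrA lb ?mulr0.
Qed.

End Socle.

(** * Chain conditions on left ideals *)

(** The ascending chain condition on left ideals, as a maximality principle for
    indexed families. *)
Definition left_noetherian (R : pzRingType) : Prop :=
  forall (T : Type) (P : T -> Prop) (f : T -> set R) t0,
    P t0 -> (forall t, P t -> left_ideal (f t)) ->
  exists t, P t /\ forall t', P t' -> f t `<=` f t' -> f t' `<=` f t.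

Lemma double_annihilator_noetherian (R : pzRingType) :
    (forall I : set R, left_ideal I -> lann (rann I) = I) ->
  rann_dcc R -> left_noetherian R.
Proof.
move=> closedR dccR T P f t0 P0 lf.
have [t [Pt tmin]] := rann_minimal dccR f P0.
exists t; split=> // t' Pt' tt'.
rewrite -(closedR _ (lf _ Pt)) -(closedR _ (lf _ Pt')).
by apply/lannS/tmin/rannS.
Qed.

Section LeftArtinian.
Variables (R : pzRingType) (injR : @ideal_injective R R^o).
Hypothesis dccR : rann_dcc R.

Definition artinian_above (I : set R) : Prop :=
  forall W : nat -> set R, (forall n, left_ideal (W n)) ->
    (forall n, W n.+1 `<=` W n) -> (forall n, I `<=` W n) ->
  exists n, forall m, (n <= m)%N -> W n `<=` W m.

Definition add_ideal (I J : set R) : set R :=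
  [set x | exists i j, [/\ I i, J j & x = i + j]].

Lemma add_ideal_left (I J : set R) :
  left_ideal I -> left_ideal J -> left_ideal (add_ideal I J).
Proof.
move=> [I0 ID IZ] [J0 JD JZ]; split.
- by exists 0, 0; rewrite addr0.
- move=> _ _ [i [j [Ii Jj ->]]] [i' [j' [Ii' Jj' ->]]].
  by exists (i + i'), (j + j'); rewrite addrACA; split; [apply: ID|apply: JD|].
- move=> r _ [i [j [Ii Jj ->]]]; exists (r * i), (r * j).
  by rewrite mulrDr; split; [apply: IZ|apply: JZ|].
Qed.

(** A chain either stays above [J], or meets [J] in [I] eventually; in the second
    case its terms are determined by their sums with [J], by the modular law. *)
Lemma artinian_above_ext (I J : set R) : left_ideal J -> I `<=` J ->
    (forall W, left_ideal W -> I `<=` W -> J `<=` W \/ W `&` J `<=` I) ->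
  artinian_above J -> artinian_above I.
Proof.
move=> lJ IJ simpleJ aJ W lW decW IW.
have [JW|/existsNP[n0 nJW]] := pselect (forall n, J `<=` W n); first exact: aJ.
have WJ n : (n0 <= n)%N -> W n `&` J `<=` I.
  move=> n0n; case: (simpleJ _ (lW n) (IW n)) => // JWn; case: nJW.
  by apply: subset_trans JWn _; apply: decreasing_chain.
have [|||n1 n1P] := aJ (fun n => add_ideal (W n) J).
- by move=> n; apply: add_ideal_left.
- by move=> n _ [w [j [Ww Jj ->]]]; exists w, j; split=> //; apply: decW.
- by move=> n j Jj; exists 0, j; rewrite add0r; split=> //; case: (lW n).
exists (maxn n0 n1) => m; rewrite geq_max => /andP[n0m n1m] w Ww.
have [|w' [j [Ww' Jj wE]]] := n1P m n1m w.
  exists w, 0; rewrite addr0; split=> //; last by case: lJ.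
  by apply: decreasing_chain Ww => //; apply: leq_maxr.
have [_ WD _] := lW m; rewrite wE; apply: WD => //; apply: (IW m).
apply: (WJ n0) => //; split=> //; have -> : j = w - w' by rewrite wE addrC addKr.
apply: left_idealB => //; last exact: decreasing_chain Ww'.
by apply: decreasing_chain Ww => //; apply: leq_maxl.
Qed.

(** Take [x] outside [I], killed modulo [I] by the singular ideal, and with a
    maximal annihilator modulo [I]; then [I + R x] is simple modulo [I]. If [W]
    met it in more without containing [x], the left ideal of the [r] with
    [r * x] in [W] would be generated by an idempotent [g] modulo singular
    elements, and [(1 - g) * x] would have a larger annihilator modulo [I]. *)
Lemma simple_extension (I : set R) : left_noetherian R -> left_ideal I -> ~ I 1 ->
  exists J, [/\ left_ideal J, I `<=` J, ~ J `<=` I &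
    forall W, left_ideal W -> I `<=` W -> J `<=` W \/ W `&` J `<=` I].
Proof.
move=> nR lI nI1; have [I0 ID IZ] := lI.
have [x0 x0P] := killed_mod_ideal dccR lI nI1.
have quot_ideal (W : set R) y : left_ideal W -> left_ideal [set r | W (r * y)].
  move=> [W0 WD WZ]; split=> /= [|r s|r s]; first by rewrite mul0r.
    by rewrite mulrDl; apply: WD.
  by rewrite -mulrA; apply: WZ.
have [|x [[nIx zIx] xmax]] := nR R
    (fun x => ~ I x /\ forall z, singular z -> I (z * x))
    (fun x => [set r | I (r * x)]) x0 x0P.
  by move=> x _; apply: quot_ideal.
have xJ : add_ideal I [set y | exists r, y = r * x] x.
  by exists 0, x; rewrite add0r; split=> //; exists 1; rewrite mul1r.
exists (add_ideal I [set y | exists r, y = r * x]); split.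
- apply: add_ideal_left => //; split; first by exists 0; rewrite mul0r.
    by move=> _ _ [r ->] [s ->]; exists (r + s); rewrite mulrDl.
  by move=> r _ [s ->]; exists (r * s); rewrite mulrA.
- by move=> i Ii; exists i, 0; rewrite addr0; split=> //; exists 0; rewrite mul0r.
- by move=> /(_ x xJ).
move=> W lW IW; have [W0 WD WZ] := lW.
pose P := [set r | W (r * x)].
have [Wx|nWx] := pselect (W x).
  by left=> _ [i [_ [Ii [r ->] ->]]]; apply: WD (WZ _ _ Wx); apply: IW.
right=> u [Wu [i [_ [Ii [r ->] uE]]]]; rewrite uE; apply: ID => //.
have Pr : P r.
  rewrite /P /=; have -> : r * x = u - i by rewrite uE addrC addKr.
  by apply: left_idealB => //; apply: IW.
have [||g [gg Pg gP]] := idempotent_generator injR dccR (Q := P).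
- exact: quot_ideal.
- by move=> z sz; apply/IW/zIx.
have PI p : P p -> I (p * ((1 - g) * x)).
  by move=> /gP; rewrite mulrA mulrBr mulr1 => /zIx.
apply: (xmax ((1 - g) * x)); last exact: PI.
- split; last by move=> z sz; rewrite mulrA; apply: zIx; apply: singularMr.
  move=> /IW; rewrite mulrBl mul1r => Wgx; apply: nWx.
  by rewrite -(subrK (g * x) x); apply: WD.
- by move=> p Ip; apply: PI; apply: IW.
Qed.

(** Noetherian induction: a maximal [I] above which some chain does not stabilize
    has a simple extension, above which all chains do. *)
Lemma noetherian_artinian : left_noetherian R -> left_artinian R.
Proof.
move=> nR.
suff a0 : artinian_above [set 0].
  move=> W lW decW; have [|n nP] := a0 W lW decW; first by move=> n _ ->; case: (lW n).
  exists n => m nm; apply/seteqP; split; last exact: nP.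
  exact: decreasing_chain.
apply: contrapT => na0.
have [||I [[lI naI] maxI]] :=
  nR _ (fun I => left_ideal I /\ ~ artinian_above I) id [set 0].
- by split=> //; split=> [//|x y -> ->|r x ->]; rewrite ?addr0 ?mulr0.
- by move=> I [].
have [I1|nI1] := pselect (I 1).
  apply: naI => W lW _ IW; exists 0%N => m _ x _.
  by have [_ _ WZ] := lW m; rewrite -[x]mulr1; apply/WZ/IW.
have [J [lJ IJ nJI simpleJ]] := simple_extension nR lI nI1.
apply: naI; apply: (artinian_above_ext lJ IJ simpleJ).
by apply: contrapT => naJ; apply: nJI; apply: maxI.
Qed.

End LeftArtinian.

(** * Right ideals *)

Lemma artinian_dcc (R : pzRingType) (T : Type) (P : T -> Prop) (f : T -> set R) t0 :
    left_artinian R -> (forall t, P t -> left_ideal (f t)) -> P t0 ->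
  exists t, P t /\ forall t', P t' -> f t' `<=` f t -> f t `<=` f t'.
Proof.
move=> aR lf P0; apply: minimal_member P0 => t Pt decf.
have [|n nP] := aR (fun n => f (t n)) _ decf; first by move=> n; apply: lf.
by exists n; rewrite nP.
Qed.

Section RightIdeals.
Variables (R : pzRingType) (injR : @ideal_injective R R^o) (aR : left_artinian R).

(** An element [y] annihilated by the left annihilator of [K + x R] defines a map
    [r * x |-> r * y] on [lann K * x]. It is right multiplication by some [c], and
    then [y - x * c] is in the double annihilator of [K]. *)
Lemma right_double_annihilator_add (K : set R) x : rann (lann K) = K ->
  let K' := [set y | exists k r, K k /\ y = k + x * r] in rann (lann K') = K'.
Proof.
move=> closedK K'; apply/seteqP; split; last exact: rann_lann.
(* On the left annihilator of K, r x determines r y. *)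
move=> y ly; pose G u v := exists r, [/\ lann K r, u = r * x & v = r * y].
have [L0 LD LZ] := lann_ideal K.
have [||||c cP] := extend_relation injR (G := G).
- by exists 0; rewrite !mul0r.
- move=> _ _ _ _ [r [lr -> ->]] [r' [lr' -> ->]]; exists (r + r').
  by rewrite !mulrDl; split=> //; apply: LD.
- by move=> s _ _ [r [lr -> ->]]; exists (s * r); rewrite !mulrA; split=> //; apply: LZ.
- move=> _ [r [lr /esym rx ->]]; apply: ly => _ [k [s [Kk ->]]].
  by rewrite mulrDr lr // mulrA rx mul0r addr0.
exists (y - x * c), c; rewrite subrK; split=> //; rewrite -closedK => r lr.
by rewrite mulrBr mulrA -(cP (r * x) (r * y)) ?subrr //; exists r.
Qed.

(** A right ideal contained in [K], equal to its double annihilator and with the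
    smallest left annihilator cannot be enlarged inside [K] by one generator. *)
Lemma right_double_annihilator (K : set R) : @left_ideal R^c K -> rann (lann K) = K.
Proof.
move=> [K0 KD KZ].
have [||K' [[closedK' K'K] minK']] := artinian_dcc (T := set R)
    (P := fun K' => rann (lann K') = K' /\ K' `<=` K) (f := @lann R) (t0 := [set 0]) aR.
- by move=> K' _; apply: lann_ideal.
- split=> [|x -> //]; apply/seteqP; split; last exact: rann_lann.
  by move=> x lx /=; rewrite -[x]mul1r; apply: lx => _ ->; rewrite mulr0.
suff -> : K = K' by [].
apply/seteqP; split=> // x Kx.
pose K1 := [set y | exists k r, K' k /\ y = k + x * r].
have K'K1 : K' `<=` K1 by move=> k K'k; exists k, 0; rewrite mulr0 addr0.
have le : lann K' `<=` lann K1.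
  apply: minK' (lannS K'K1); split; first exact: right_double_annihilator_add.
  by move=> _ [k [r [K'k ->]]]; apply: KD; [apply: K'K|apply: (KZ r x)].
rewrite -closedK'; apply: (rannS le); apply: rann_lann.
exists 0, 1; rewrite mulr1 add0r; split=> //.
by rewrite -closedK' => r _; rewrite mulr0.
Qed.

Hypothesis closedR : forall I : set R, left_ideal I -> lann (rann I) = I.
Hypothesis nR : left_noetherian R.

Lemma right_artinian : left_artinian R^c.
Proof.
move=> K rK decK.
have [||n [_ nP]] := nR (P := fun=> True) (f := fun n => @lann R (K n)) (t0 := 0%N).
- by [].
- by move=> n _; apply: lann_ideal.
exists n => m nm; have Kmn := @decreasing_chain R K decK n m nm.
apply/seteqP; split=> //.
rewrite -(right_double_annihilator (rK m)) -(right_double_annihilator (rK n)).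
apply: (@rannS R); apply: nP => //.
exact: (@lannS R).
Qed.

(** Taking annihilators is an inclusion-reversing bijection between left and
    right ideals, so it turns intersections into sums. *)
Lemma lann_setI (A B : set R) : @left_ideal R^c A -> @left_ideal R^c B ->
  lann (A `&` B) `<=` add_ideal (lann A) (lann B).
Proof.
move=> rA rB; rewrite -[add_ideal _ _]closedR; last first.
  by apply: add_ideal_left; apply: lann_ideal.
have [A0 _ _] := lann_ideal A; have [B0 _ _] := lann_ideal B.
apply: lannS => x Nx; split.
  rewrite -(right_double_annihilator rA) => a la; apply: Nx.
  by exists a, 0; rewrite addr0.
rewrite -(right_double_annihilator rB) => b lb; apply: Nx.
by exists 0, b; rewrite add0r.
Qed.

(** Among the right ideals on which the given homomorphism is a left
    multiplication, take one with the smallest left annihilator. One more element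
    [x] of the domain can always be added: on [x R] the homomorphism is a left
    multiplication since [R x] is a double annihilator, and the two multipliers
    are reconciled by [lann_setI]. *)
Lemma right_self_injective : @ideal_injective R^c (R^c)^o.
Proof.
move=> G sG uG; have [G0 GD GZ] := sG.
pose good (K : set R) := @left_ideal R^c K /\ exists y : R, forall k, K k -> G (k, y * k).
have [||K [[rK [y yP]] minK]] :=
  artinian_dcc (P := good) (f := @lann R) (t0 := [set 0]) aR.
- by move=> K _; apply: lann_ideal.
- split; last by exists 0 => _ ->; rewrite mulr0.
  by split=> [//|x x' -> ->|r x ->]; rewrite ?addr0 ?mulr0.
exists y => x n Gxn.
pose xR := [set v : R | exists s, v = (x : R) * s].
have rxR : @left_ideal R^c xR.
  split; first by exists 0; rewrite mulr0.
    by move=> _ _ [s ->] [t ->]; exists (s + t); rewrite mulrDr.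
  by move=> r _ [s ->]; exists (s * r : R); rewrite mulrA.
have GZ' s u v : G (u, v) -> G ((u : R) * s, (v : R) * s) by apply: (GZ s (u, v)).
have [z nE] : exists z : R, n = z * (x : R).
  pose Rx := [set v : R | exists s, v = s * (x : R)].
  have lRx : left_ideal Rx.
    split; first by exists 0; rewrite mul0r.
      by move=> _ _ [s ->] [t ->]; exists (s + t); rewrite mulrDl.
    by move=> r _ [s ->]; exists (r * s); rewrite mulrA.
  suff : Rx n by [].
  rewrite -(closedR lRx) => s xs; apply: uG.
  have /= := GZ' s _ _ Gxn; rewrite xs //; by exists 1; rewrite mul1r.
(* Multiplication by y on K and by z on x R agree on the intersection; the
   splitting of y - z lets both be corrected to one multiplier. *)
have [|a [b [la lb yzE]]] := @lann_setI K xR rK rxR (y - z).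
  move=> k [Kk [s kE]]; rewrite mulrBl; apply/eqP; rewrite subr_eq0; apply/eqP.
  apply: (univalentP sG uG (yP k Kk)).
  by rewrite kE mulrA -nE; apply: GZ'.
pose y' := y - a.
have y'K k : K k -> y' * k = y * k by move=> Kk; rewrite mulrBl la ?subr0.
have y'x : y' * (x : R) = n.
  have -> : y' = z + b.
    by apply/eqP; rewrite subr_eq -(subrK z y) yzE addrC [a + b]addrC addrA.
  by rewrite mulrDl -nE lb ?addr0 //; exists 1; rewrite mulr1.
pose K1 := [set v : R | exists k s, K k /\ v = k + (x : R) * s].
have [K0 KD KZ] := rK.
have KK1 : K `<=` K1 by move=> k Kk; exists k, 0; rewrite mulr0 addr0.
have le : lann K `<=` lann K1.
  apply: minK (lannS KK1); split.
    split; first exact: KK1.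
      move=> _ _ [k [s [Kk ->]]] [k' [s' [Kk' ->]]]; exists (k + k'), (s + s').
      by rewrite mulrDr addrACA; split=> //; apply: KD.
    move=> r _ [k [s [Kk ->]]]; exists (k * r : R), (s * r : R).
    by split; [apply: KZ|rewrite [LHS]mulrDl mulrA].
  exists y' => _ [k [s [Kk ->]]]; rewrite mulrDr mulrA y'x y'K //.
  exact: (GD (_, _) (_, _) (yP k Kk) (GZ' s _ _ Gxn)).
have Kx : K x.
  rewrite -(right_double_annihilator rK); apply: (rannS le); apply: rann_lann.
  by exists 0, 1; rewrite mulr1 add0r.
exact: (univalentP sG uG Gxn (yP x Kx)).
Qed.

End RightIdeals.

(** * The equivalence *)

(** Take a maximal left ideal [J] whose action is controlled by finitely many of
    the congruences. It contains every [I a], so a solution of the finitely many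
    congruences solves them all. *)
Lemma noetherian_semi_compact (R : pzRingType) (M : lmodType R) :
  left_noetherian R -> semi_compact M.
Proof.
move=> nR L x I lI sol.
pose good (J : set R) := left_ideal J /\ exists F : set L, finite_set F /\
  forall m : M, (forall a, F a -> annihilated (I a) m) -> annihilated J m.
have [||J [[lJ [F [finF FJ]]] maxJ]] := nR _ good id [set 0].
- split; first by split=> [//|u v -> ->|r u ->]; rewrite ?addr0 ?mulr0.
  by exists set0; split; [exact: finite_set0|move=> m _ _ ->; rewrite scale0r].
- by move=> J [].
have IJ a : I a `<=` J.
  apply: subset_trans (maxJ (add_ideal J (I a)) _ _).
  - by move=> r Ir; exists 0, r; rewrite add0r; split=> //; case: lJ.
  - split; first exact: add_ideal_left.
    exists (F `|` [set a]); split; first by rewrite finite_setU; split.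
    move=> m Fm _ [j [i [Jj Ii ->]]]; rewrite scalerDl (FJ m) //; last first.
      by move=> b Fb; apply: Fm; left.
    by rewrite (Fm a) ?addr0 //; right.
  - move=> j Jj; exists j, 0; rewrite addr0; split=> //; by case: (lI a).
have [y yP] := sol F finF; exists y => a r Ir.
have [|z zP] := sol (F `|` [set a]); first by rewrite finite_setU; split.
have -> : y - x a = (y - z) + (z - x a) by rewrite addrA subrK.
rewrite scalerDr (zP a _ r Ir) ?addr0; last by right.
apply: FJ; last exact: IJ Ir.
move=> b Fb s Is; have -> : y - z = (y - x b) - (z - x b) by rewrite opprB addrA subrK.
by rewrite scalerBr (yP b Fb) ?(zP b) ?subrr //; left.
Qed.

Theorem corollary2p5 (R : pzRingType) (hR : self_left_semi_injective R) :
  (forall M : lmodType R, flat M -> semi_compact M) <-> quasi_Frobenius R.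
Proof.
split=> [cR|[_ raR _ riR] M _].
  have injR := semi_compact_self_injective hR (cR _ (@regular_flat R)).
  have dccR := semi_compact_rann_dcc (cR _ (@free_module_flat R)).
  have closedR := left_double_annihilator injR dccR.
  have nR := double_annihilator_noetherian closedR dccR.
  have laR := noetherian_artinian injR dccR nR.
  split=> //; first exact: right_artinian.
    exact: baer.
  by apply: baer; apply: right_self_injective.
apply: noetherian_semi_compact; apply: double_annihilator_noetherian.
  move=> I lI.
  exact: (@right_double_annihilator R^c (injective_ideal_injective riR) raR I lI).
move=> X decX.
have [|n nP] := raR (fun n => rann (X n)) _ decX; first by move=> n; apply: rann_ideal.
by exists n; rewrite nP.
Qed.
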